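(* Let $n\ge 2$, and let $(T_1,\ldots,T_n)$ be a $\mathcal{U}_n$-twisted contraction on a complex Hilbert space $\mathcal{H}$. Then there exist $2^n$ closed subspaces $\{\mathcal{H}_{A_n} : A_n\subseteq I_n\}$ of $\mathcal{H}$ (counting the trivial subspace $\{0\}$), each reducing all of $T_1,\ldots,T_n$, such that $$\mathcal{H}=\bigoplus_{A_n\subseteq I_n}\mathcal{H}_{A_n}\quad\text{(orthogonal direct sum)},$$ where, with $A_{n-1}:=A_n\setminus\{n\}\subseteq I_{n-1}$ and $\mathcal{H}_{A_{n-1}}$ the subspace defined recursively in the context, $$\mathcal{H}_{A_n}=\bigcap_{m_n\in\mathbb{Z}_+}\Big[\mathcal{N}\big((I-T_n^{*m_n}T_n^{m_n})|_{\mathcal{H}_{A_{n-1}}}\big)\cap\mathcal{N}\big((I-T_n^{m_n}T_n^{*m_n})|_{\mathcal{H}_{A_{n-1}}}\big)\Big]\quad\text{if } n\notin A_n,$$ $$\mathcal{H}_{A_n}=\bigvee_{m_n\in\mathbb{Z}_+}\Big\{(I-T_n^{*m_n}T_n^{m_n})\mathcal{H}_{A_{n-1}}\cup(I-T_n^{m_n}T_n^{*m_n})\mathcal{H}_{A_{n-1}}\Big\}\quad\text{if } n\in A_n.$$ For each $A_n\subseteq I_n$ with $\mathcal{H}_{A_n}\neq\{0\}$ and each $i=1,\ldots,n$, the operator $T_i|_{\mathcal{H}_{A_n}}$ is unitary if $i\notin A_n$ and completely non-unitary if $i\in A_n$. Moreover, this decomposition is unique: it is the only orthogonal decomposition of $\mathcal{H}$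 into closed subspaces indexed by the subsets of $I_n$, each reducing all the $T_i$, with these unitary / completely non-unitary properties.
   Context: $\mathcal{H}$ is a complex Hilbert space, $I$ the identity operator, $\mathbb{Z}_+=\{0,1,2,\ldots\}$. $\mathcal{N}(T)$ is the kernel of $T$; $\bigvee \mathcal{M}$ is the closed linear span of $\mathcal{M}$. For a closed subspace $\mathcal{M}$ and a bounded operator $S$, $S|_{\mathcal{M}}$ is the restriction, so $\mathcal{N}(S|_{\mathcal{M}})=\mathcal{M}\cap\mathcal{N}(S)$. A closed subspace $\mathcal{M}$ reduces $T$ if $T\mathcal{M}\subseteq\mathcal{M}$ and $T\mathcal{M}^\perp\subseteq\mathcal{M}^\perp$. A contraction is an operator $T$ with $\|Th\|\le\|h\|$ for all $h$. A contraction is completely non-unitary (c.n.u.) if there is no nonzero reducing subspace on which its restriction is unitary. $\mathcal{U}_n$-twisted contraction ($n>1$): let $\{U_{ij}\}_{1\le i<j\le n}$ be $\binom n2$ commuting unitaries on $\mathcal{H}$ and put $U_{ji}:=U_{ij}^*$. An $n$-tuple of contractions $(T_1,\ldots,T_n)$ on $\mathcal{H}$ is a $\mathcal{U}_n$-twisted contraction with respect to the twist $\{U_{ij}\}_{i<j}$ if $$T_iT_j=U_{ij}T_jT_i,\qquad T_i^*T_j=U_{ij}^*T_jT_i^*,\qquad T_kU_{ij}=U_{ij}T_k$$ for all $i,j,k=1,\ldots,n$ with $i\ne j$. The phrase ''$\mathcal{U}_n$-twisted contraction'' means with respect to some such twist. Index notation: $I_p=\{1,\ldots,p\}$ for $1\le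 p\le n$, $I_0=\emptyset$, and $A_p$ denotes an arbitrary subset of $I_p$ (possibly empty). The subspaces $\mathcal{H}_{A_p}$ depend on $p$ as well as on the set (the same set viewed as a subset of $I_p$ or of $I_{p+1}$ gives different subspaces). They are defined recursively: for $p=0$, $\mathcal{H}_{A_0}=\mathcal{H}$; for $1\le p\le n-1$ and $A_p\subseteq I_p$, with $A_{p-1}:=A_p\setminus\{p\}\subseteq I_{p-1}$, $$\mathcal{H}_{A_p}=\bigcap_{m\in\mathbb{Z}_+}\big[\mathcal{N}((I-T_p^{*m}T_p^{m})|_{\mathcal{H}_{A_{p-1}}})\cap\mathcal{N}((I-T_p^{m}T_p^{*m})|_{\mathcal{H}_{A_{p-1}}})\big]\ \text{ if } p\notin A_p,$$ $$\mathcal{H}_{A_p}=\bigvee_{m\in\mathbb{Z}_+}\{(I-T_p^{*m}T_p^{m})\mathcal{H}_{A_{p-1}}\cup(I-T_p^{m}T_p^{*m})\mathcal{H}_{A_{p-1}}\}\ \text{ if } p\in A_p.$$ *)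

(* Defs.v *)
From HB Require Import structures.
From mathcomp Require Import all_boot all_order all_algebra.
From mathcomp Require Import sesquilinear complex.
From mathcomp Require Import all_classical all_reals all_analysis.

Set Implicit Arguments.
Unset Strict Implicit.
Unset Printing Implicit Defensive.

Import Order.TTheory GRing.Theory Num.Theory.
Import numFieldNormedType.Exports.

Local Open Scope classical_set_scope.
Local Open Scope ring_scope.
Local Open Scope complex_scope.

(* Complex Hilbert spaces: the inner product is linear in its first argument
   and conjugate-linear in the second one. *)
HB.mixin Record CompleteNormedModule_isHilbert (R : realType) H
    & CompleteNormedModule R[i] H := {
  inner : {dot H for Num.Def.conjC};
  norm_inner : forall x : H, `|x| ^+ 2 = inner x x
}.

#[short(type="hilbertType")]
HB.structure Definition Hilbert (R : realType) :=
  {H of CompleteNormedModule R[i] H & CompleteNormedModule_isHilbert R H}.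

Section HilbertOperators.
Variables (R : realType) (H : hilbertType R).
Implicit Types (M L : set H) (S T : H -> H).

Local Notation "''[' x , y ]" := (@inner R H x y) : ring_scope.

Definition closed_subspace M := submod_closed (mem M) /\ closed M.

Definition closed_span (A : set H) : set H := smallest closed_subspace A.

Definition orthocomp M : set H := [set y | forall x, M x -> '[x, y] = 0].

(* Total on arbitrary functions; it is the Hilbert-space adjoint whenever T is
   linear and bounded, by the Riesz representation theorem. *)
Definition adjoint T : H -> H :=
  fun y => xget 0 [set z | forall x, '[T x, y] = '[x, z]].

(* L reduces the restriction of T to M, seen as an operator on the Hilbert
   space M, in which the orthogonal complement of L is M `&` orthocomp L. *)
Definition reduces_in M T L :=
  [/\ closed_subspace L, L `<=` M, T @` L `<=` L &
      T @` (M `&` orthocomp L) `<=` M `&` orthocomp L].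

Definition reduces T L := reduces_in setT T L.

Definition unitary_on M T :=
  T @` M = M /\ forall x y, M x -> M y -> '[T x, T y] = '[x, y].

Definition unitary T := unitary_on setT T.

(* L ranges over the subspaces of M that reduce the restriction of T to M. *)
Definition cnu_on M T :=
  forall L, reduces_in M T L -> unitary_on L T -> L = [set 0].

Definition contractive T := forall h, `|T h| <= `|h|.

Definition ker_on M S : set H := M `&` [set h | S h = 0].

(* I - S^m T^m *)
Definition defect S T (m : nat) : H -> H :=
  fun h => h - iter m S (iter m T h).

Definition unitary_part T M : set H :=
  \bigcap_(m in [set: nat])
    (ker_on M (defect (adjoint T) T m) `&` ker_on M (defect T (adjoint T) m)).

Definition cnu_part T M : set H :=
  closed_span (\bigcup_(m in [set: nat])
    (defect (adjoint T) T m @` M `|` defect T (adjoint T) m @` M)).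

(* init_set A is A minus ord_max, seen as a subset of the first p indices. *)
Definition init_ops p (T : 'I_p.+1 -> H -> H) : 'I_p -> H -> H :=
  fun i => T (widen_ord (leqnSn p) i).

Definition init_set p (A : {set 'I_p.+1}) : {set 'I_p} :=
  (widen_ord (leqnSn p) @^-1: A)%SET.

(* The subspace H_{A_p}; in 1-based numbering, p is the index ord_max of 'I_p. *)
Fixpoint wold_space p : ('I_p -> H -> H) -> {set 'I_p} -> set H :=
  match p with
  | 0 => fun _ _ => setT
  | q.+1 => fun (T : 'I_q.+1 -> H -> H) (A : {set 'I_q.+1}) =>
      (if ord_max \in A then cnu_part else unitary_part)
        (T ord_max) (wold_space (init_ops T) (init_set A))
  end.

Section Tuples.
Variable n : nat.

(* Only the U i j with i < j matter. *)
Definition twist (U : 'I_n -> 'I_n -> {linear H -> H}) (i j : 'I_n) : H -> H :=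
  if (i < j)%N then (U i j : H -> H) else adjoint (U j i).

Definition commuting_unitaries (U : 'I_n -> 'I_n -> {linear H -> H}) :=
  (forall i j : 'I_n, (i < j)%N -> unitary (U i j)) /\
  (forall i j k l : 'I_n, (i < j)%N -> (k < l)%N ->
    U i j \o U k l =1 U k l \o U i j).

Definition twisted_contraction_wrt (U : 'I_n -> 'I_n -> {linear H -> H})
    (T : 'I_n -> {linear H -> H}) :=
  [/\ commuting_unitaries U, forall i, contractive (T i) &
      forall i j k : 'I_n, i != j ->
      [/\ T i \o T j =1 twist U i j \o T j \o T i,
          adjoint (T i) \o T j =1 adjoint (twist U i j) \o T j \o adjoint (T i) &
          T k \o twist U i j =1 twist U i j \o T k]].

Definition twisted_contraction (T : 'I_n -> {linear H -> H}) :=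
  exists U, twisted_contraction_wrt U T.

Definition orthogonal_sum (K : {set 'I_n} -> set H) :=
  (forall A B, A != B -> forall x y, K A x -> K B y -> '[x, y] = 0) /\
  (forall h, exists2 f : {set 'I_n} -> H,
     forall A, K A (f A) & h = \sum_(A : {set 'I_n}) f A).

Definition unitary_cnu_decomposition (T : 'I_n -> H -> H)
    (K : {set 'I_n} -> set H) :=
  [/\ forall A, closed_subspace (K A),
      forall A i, reduces (T i) (K A),
      orthogonal_sum K &
      forall A, K A <> [set 0] -> forall i,
        (i \notin A -> unitary_on (K A) (T i)) /\
        (i \in A -> cnu_on (K A) (T i))].

End Tuples.

End HilbertOperators.

(* Main.v *)
Require Import Defs.
From mathcomp Require Import all_boot all_order all_algebra.
From mathcomp Require Import sesquilinear complex.
From mathcomp Require Import all_classical all_reals all_analysis.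
From mathcomp Require Import ring lra.

Set Implicit Arguments.
Unset Strict Implicit.
Unset Printing Implicit Defensive.

Import Order.TTheory GRing.Theory Num.Theory.
Import numFieldNormedType.Exports.

Local Open Scope classical_set_scope.
Local Open Scope ring_scope.

(** Call [Hu T] the space of the vectors on which all powers of a contraction
    T and of its adjoint are isometric. A reducing subspace on which T is
    unitary lies in [Hu T], and [Hu T] itself reduces T to a unitary; so T is
    unitary on a reducing subspace M exactly when M is contained in [Hu T],
    and completely non-unitary on M exactly when M meets [Hu T] only in 0. In
    particular T is completely non-unitary on the orthogonal complement of
    [Hu T].

    For a twisted family the relations between T_i and T_j make the twist
    cancel in T_i^*^m T_i^m T_j and in T_i^m T_i^*^m T_j: the defect operators
    of T_i commute with T_j ([iter_twist]), so that their common kernel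
    [Hu T_i] reduces T_j ([twist_bistable]). Hence the
    splittings of H into [Hu T_i] and its orthogonal complement are compatible
    with each other and with all the T_j. Everything is then read off the
    explicit spaces
      E_A = (the intersection of the Hu T_i, i not in A)
            `&` (the intersection of the orthocomp (Hu T_i), i in A),
    called [joint_type_space] below.
    - The recursively defined spaces are the E_A ([wold_spaceE]), because on a
      subspace M that reduces T the two recursion steps cut out M `&` Hu T
      ([unitary_partE]) and M `&` orthocomp (Hu T) ([cnu_partE]).
    - The E_A are pairwise orthogonal and reducing, with the right types, and
      a vector is split along one T_i after the other
      ([joint_type_space_decomposition]).
    - In any other decomposition K, the components of a vector of [Hu T_i]
      stay in [Hu T_i], hence vanish in the K A with i in A. So K A is
      contained in E_A for all A, and two orthogonal decompositions that are
      so nested coincide ([decomposition_unique]).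

    The orthogonal projection onto a closed subspace and the Riesz
    representation theorem, on which the existence of adjoints rests, are
    proved in the first part. *)

(** * Geometry of Hilbert spaces *)

Section Hilbert.
Variables (R : realType) (H : hilbertType R).
Implicit Types (x y z u v : H) (a : R[i]) (M C : set H) (T S : H -> H).

Local Notation "''[' x , y ]" := (@inner R H x y) : ring_scope.

Lemma innerDl x y z : '[x + y, z] = '[x, z] + '[y, z].
Proof. exact: linearDl. Qed.
Lemma innerBl x y z : '[x - y, z] = '[x, z] - '[y, z].
Proof. exact: linearBl. Qed.
Lemma innerZl a x z : '[a *: x, z] = a * '[x, z].
Proof. exact: linearZl_LR. Qed.
Lemma inner_conj x y : '[y, x] = Num.conj '[x, y].
Proof. by rewrite hermC expr0 mul1r. Qed.
Lemma innerDr x y z : '[z, x + y] = '[z, x] + '[z, y].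
Proof. exact: linearDr. Qed.
Lemma innerBr x y z : '[z, x - y] = '[z, x] - '[z, y].
Proof. exact: linearBr. Qed.
Lemma innerZr a x z : '[z, a *: x] = Num.conj a * '[z, x].
Proof. exact: linearZr. Qed.
Lemma inner0l x : '[0, x] = 0.
Proof. exact: linear0l. Qed.
Lemma inner0r x : '[x, 0] = 0.
Proof. exact: linear0r. Qed.
Lemma inner_eq0 x : '[x, x] = 0 -> x = 0.
Proof. by move/eqP; rewrite dnorm_eq0 => /eqP. Qed.
Lemma inner_sumr (I : finType) (f : I -> H) x :
  '[x, \sum_i f i] = \sum_i '[x, f i].
Proof. exact: linear_sumr. Qed.

(** Positivity of the inner product on the vector '[y, y] *: x - '[x, y] *: y,
    a multiple of the component of x orthogonal to y. *)
Lemma cauchy_schwarz x y : `|'[x, y]| <= `|x| * `|y|.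
Proof.
have [->|y0] := eqVneq y 0; first by rewrite inner0r !normr0 mulr0.
rewrite -(@ler_pXn2r _ 2%N) ?nnegrE ?mulr_ge0 // exprMn !norm_inner.
have yy0 : 0 < '[y, y] by rewrite dnorm_gt0.
have := dnorm_ge0 (@inner R H) ('[y, y] *: x - '[x, y] *: y).
have -> : '['[y, y] *: x - '[x, y] *: y, '[y, y] *: x - '[x, y] *: y] =
    '[y, y] * ('[x, x] * '[y, y] - `|'[x, y]| ^+ 2).
  rewrite innerBl !innerBr !innerZl !innerZr normCK -!inner_conj.
  by ring.
by rewrite pmulr_rge0 // subr_ge0.
Qed.

Lemma bounded_kernel_closed (f : H -> R[i]) (k : R[i]) : 0 <= k ->
  {morph f : x y / x - y} -> (forall x, `|f x| <= k * `|x|) ->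
  closed [set x | f x = 0].
Proof.
move=> k0 fB fk p clp /=; apply: contrapT => /eqP fp0.
have k1 : 0 < k + 1 by rewrite ltr_wpDl.
have e0 : 0 < `|f p| / (k + 1) by rewrite divr_gt0 // normr_gt0.
have [q [/= fq0]] := clp _ (nbhsx_ballx p _ e0).
rewrite -ball_normE /= ltr_pdivlMr // => ltpq.
suff : `|f p| < `|f p| by rewrite ltxx.
rewrite -{1}[f p]subr0 -fq0 -fB (le_lt_trans (fk _))// (le_lt_trans _ ltpq)//.
rewrite mulrC ler_wpM2l //.
by rewrite ler_wpDr.
Qed.

Lemma closed_forall (I : Type) (F : I -> set H) :
  (forall i, closed (F i)) -> closed [set x | forall i, F i x].
Proof. by move=> Fc x clx i; apply: Fc => B /clx[y [Fy By]]; exists y. Qed.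

Lemma closed_subspace_intro M : closed M -> M 0 ->
  (forall a x y, M x -> M y -> M (a *: x + y)) -> closed_subspace M.
Proof.
move=> cM M0 ML; split=> //; split; first by rewrite inE.
by move=> a x y; rewrite !inE; apply: ML.
Qed.

Section Subspace.
Variables (M : set H) (cM : closed_subspace M).
Lemma subspace_closed : closed M. Proof. by case: cM. Qed.
Lemma subspace0 : M 0. Proof. by case: cM => -[]; rewrite inE. Qed.
Lemma subspaceZD a x y : M x -> M y -> M (a *: x + y).
Proof.
by case: cM => -[_ ML] _ Mx My; have := ML a x y; rewrite !inE; apply.
Qed.
Lemma subspaceD x y : M x -> M y -> M (x + y).
Proof. by move=> Mx My; rewrite -[x]scale1r; apply: subspaceZD. Qed.
Lemma subspaceZ a x : M x -> M (a *: x).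
Proof. by move=> Mx; rewrite -[_ *: _]addr0; apply: subspaceZD subspace0. Qed.
Lemma subspaceB x y : M x -> M y -> M (x - y).
Proof. by move=> Mx My; rewrite -scaleN1r addrC; apply: subspaceZD. Qed.
End Subspace.

Lemma closed_subspace_forall (I : Type) (F : I -> set H) :
  (forall i, closed_subspace (F i)) ->
  closed_subspace [set x | forall i, F i x].
Proof.
move=> cF; apply: closed_subspace_intro.
- by apply: closed_forall => i; apply: subspace_closed.
- by move=> i; apply: subspace0.
- by move=> a x y Fx Fy i; apply: (subspaceZD (cF i)); [apply: Fx|apply: Fy].
Qed.

Lemma closed_subspaceI M C :
  closed_subspace M -> closed_subspace C -> closed_subspace (M `&` C).
Proof.
move=> cM cC; apply: closed_subspace_intro.
- by apply: closedI; apply: subspace_closed.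
- by split; apply: subspace0.
- by move=> a x y [Mx Cx] [My Cy]; split; apply: subspaceZD.
Qed.

Lemma orthocomp_closed_subspace M : closed_subspace (orthocomp M).
Proof.
apply: closed_subspace_intro.
- rewrite (_ : orthocomp M = [set y | forall i : {x | M x}, '[y, sval i] = 0]).
    pose F (i : {x | M x}) : set H := [set y | '[y, sval i] = 0].
    apply: (closed_forall (F := F)) => i.
    apply: (@bounded_kernel_closed (fun y => '[y, sval i]) `|sval i|) => //.
      by move=> x y; apply: innerBl.
    by move=> x; rewrite mulrC cauchy_schwarz.
  apply/seteqP; split=> y /= My => [[x Mx]|x Mx] /=.
    by rewrite inner_conj My // conjC0.
  by rewrite inner_conj (My (exist _ x Mx)) conjC0.
- by move=> x _; rewrite inner0r.
- by move=> a x y Mx My z Mz; rewrite innerDr innerZr Mx // My // mulr0 addr0.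
Qed.

Lemma ortho_sym M x y : M x -> orthocomp M y -> '[y, x] = 0.
Proof. by move=> Mx My; rewrite inner_conj My // conjC0. Qed.

(** The norm takes its values in R[i]; the real-valued squared norm gives
    access to infima and to linear arithmetic. *)
Definition sqn x : R := complex.Re '[x, x].

Lemma sqnE x : '[x, x] = (sqn x)%:C%C.
Proof. by rewrite /sqn RRe_real // ger0_real. Qed.

Lemma sqn_norm x : `|x| ^+ 2 = (sqn x)%:C%C.
Proof. by rewrite norm_inner sqnE. Qed.

Lemma sqn_ge0 x : 0 <= sqn x.
Proof. by rewrite -ler0c -sqnE. Qed.

Lemma parallelogram x y :
  sqn (x - y) + sqn (x + y) = 2 * (sqn x + sqn y).
Proof.
apply: (@complexI R); rewrite !(rmorphD, rmorphM) /= -!sqnE.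
by rewrite innerBl !innerBr innerDl !innerDr rmorph1; ring.
Qed.

Lemma sqn_double x : sqn (x + x) = 4 * sqn x.
Proof.
have := parallelogram x x; rewrite subrr /sqn inner0l /= add0r => ->; ring.
Qed.

(** Used to pass to the limit in a minimizing sequence. *)
Lemma closed_ball_closed x (r : R) : closed [set y | sqn (x - y) <= r].
Proof.
have [r0|r0] := ltP r 0.
  rewrite (_ : [set y | _] = set0); first exact: closed0.
  by rewrite -subset0 => y /= /le_lt_trans/(_ r0); rewrite ltNge sqn_ge0.
have rE y : (sqn (x - y) <= r) = (`|x - y| <= (Num.sqrt r)%:C%C).
  rewrite -[RHS](@ler_pXn2r _ 2%N) ?nnegrE // ?ler0c ?sqrtr_ge0 //.
  by rewrite sqn_norm -rmorphXn /= lecR sqr_sqrtr.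
move=> p clp /=; rewrite rE; set s := _%:C%C.
rewrite real_leNgt ?ger0_real ?ler0c ?sqrtr_ge0 //; apply/negP => ltsp.
have e0 : 0 < `|x - p| - s by rewrite subr_gt0.
have [q [/=]] := clp _ (nbhsx_ballx p _ e0).
rewrite rE -ball_normE /= -/s => sq pq.
suff : `|x - p| < `|x - p| by rewrite ltxx.
rewrite -{1}(subrKA q) (le_lt_trans (ler_normD _ _))//.
by rewrite -[ltRHS](subrKC s) ler_ltD // distrC.
Qed.

(** The parallelogram law bounds the distance of two almost optimal points,
    because their midpoint lies in C and cannot be better than optimal. Hence
    minimizing sequences are Cauchy. *)
Lemma nearest_point C x : closed_subspace C ->
  exists2 c, C c & forall c', C c' -> sqn (x - c) <= sqn (x - c').
Proof.
move=> cC; pose E : set R := [set sqn (x - c) | c in C].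
have lbE : lbound E 0 by move=> _ [c _ <-]; apply: sqn_ge0.
have infE : has_inf E.
  by split; [exists (sqn (x - 0)), 0 => //; apply: subspace0 | exists 0].
pose d := inf E.
have dE c : C c -> d <= sqn (x - c).
  by move=> Cc; apply: (ge_inf (ex_intro _ 0 lbE)); exists c.
have [u uP] : {u : nat -> H &
    forall n, C (u n) /\ sqn (x - u n) < d + n.+1%:R^-1}.
  apply: (@choice _ _ (fun n c => C c /\ sqn (x - c) < d + n.+1%:R^-1)) => n.
  have n0 : 0 < n.+1%:R^-1 :> R by rewrite invr_gt0.
  by have [_ [c Cc <-] ltc] := inf_adherent n0 infE; exists c.
have u_dist n m : sqn (u n - u m) <= 2 * (n.+1%:R^-1 + m.+1%:R^-1).
  have [Cn dn] := uP n; have [Cm dm] := uP m.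
  have /dE dmid : C (2^-1 *: (u n + u m)).
    exact: (subspaceZ cC _ (subspaceD cC Cn Cm)).
  have := parallelogram (x - u m) (x - u n).
  have -> : x - u m - (x - u n) = u n - u m.
    by rewrite opprB addrC subrKA.
  have -> : x - u m + (x - u n) =
      (x - 2^-1 *: (u n + u m)) + (x - 2^-1 *: (u n + u m)).
    rewrite addrACA [RHS]addrACA; congr (_ + _).
    rewrite -!opprD; congr (- _).
    rewrite -scalerDl (_ : 2^-1 + 2^-1 = 1) ?scale1r 1?addrC //; by field.
  rewrite sqn_double; move: dn dm dmid.
  move: (sqn (x - u n)) (sqn (x - u m)) (sqn (u n - u m)) (sqn (x - _)).
  by move: {dE uP} d (n.+1%:R^-1) (m.+1%:R^-1) => d0 i j s1 s2 s3 s4; lra.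
have cu : cvg (u @ \oo).
  apply: cauchy_cvg; apply: cauchy_exP => e e0.
  pose r := complex.Re e.
  have er : e = r%:C%C by rewrite /r RRe_real // gtr0_real.
  have r0 : 0 < r by rewrite -ltcR -er.
  have r24 : 0 < r ^+ 2 / 4 by rewrite divr_gt0 ?exprn_gt0.
  have [N _ NP] := near_infty_natSinv_lt (PosNum r24).
  exists (u N); exists N => // n /NP /= Nn /=; rewrite -ball_normE /=.
  rewrite -(@ltr_pXn2r _ 2%N) ?nnegrE ?normr_ge0 ?(ltW e0) //.
  rewrite sqn_norm er -rmorphXn /= ltcR.
  apply: le_lt_trans (u_dist _ _) _; move: Nn (NP N (leqnn N)) => /=.
  by move: (r ^+ 2) (N.+1%:R^-1) (n.+1%:R^-1) => a i j; lra.
have Cl : C (lim (u @ \oo)).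
  by apply: (closed_cvg C (subspace_closed cC) _ _ cu); near=> n; case: (uP n).
exists (lim (u @ \oo)) => // c' Cc'; apply: le_trans (dE _ Cc').
apply/ler_addgt0Pr => e e0.
apply: (closed_cvg _ (@closed_ball_closed x (d + e)) _ _ cu).
have [N _ NP] := near_infty_natSinv_lt (PosNum e0).
exists N => // n /NP /= Nn; apply: ltW; apply: lt_trans (uP n).2 _.
by rewrite ltrD2l.
Unshelve. all: by end_near.
Qed.

(** The nearest point c is the projection: moving c within C along y by the
    component of x - c on y would shorten x - c, unless that component is 0. *)
Lemma projection C x : closed_subspace C ->
  exists2 c, C c & orthocomp C (x - c).
Proof.
move=> cC; have [c Cc cmin] := nearest_point x cC.
exists c => // y Cy; apply/eqP; rewrite inner_conj conjC_eq0.
have [->|y0] := eqVneq y 0; first by rewrite inner0r.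
have yy0 : 0 < '[y, y] by rewrite dnorm_gt0.
set v := x - c; pose a := '[v, y] / '[y, y].
have : sqn v <= sqn (v - a *: y).
  rewrite /v -addrA -opprD; apply: cmin; rewrite addrC.
  exact: subspaceZD.
rewrite -lecR -!sqnE; move: v @a => v /=; set a := _ / _.
have -> : '[v - a *: y, v - a *: y] = '[v, v] - `|'[v, y]| ^+ 2 / '[y, y].
  rewrite innerBl !innerBr !innerZl !innerZr normCK.
  rewrite /a rmorphM fmorphV /= -!inner_conj.
  by field; rewrite gt_eqF.
rewrite lerBrDl gerDr pmulr_lle0 ?invr_gt0 //.
by rewrite -normrX normr_le0 expf_eq0.
Qed.

Lemma orthocompK C : closed_subspace C -> orthocomp (orthocomp C) = C.
Proof.
move=> cC; apply/seteqP; split=> x; last by move=> Cx y Cy; apply: ortho_sym Cy.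
move=> xCC; have [c Cc xc] := projection x cC.
suff /eqP : x - c = 0 by rewrite subr_eq0 => /eqP ->.
by apply: inner_eq0; rewrite innerBr (xCC _ xc) (ortho_sym Cc xc) subr0.
Qed.

(** The functional is determined by its value on a vector d orthogonal to its
    kernel, so it is the inner product with a multiple of d. *)
Lemma riesz (f : H -> R[i]) (k : R[i]) : 0 <= k ->
  (forall a x y, f (a *: x + y) = a * f x + f y) ->
  (forall x, `|f x| <= k * `|x|) -> exists z, forall x, f x = '[x, z].
Proof.
move=> k0 fL fk.
have fB x y : f (x - y) = f x - f y.
  by rewrite addrC -scaleN1r fL mulN1r addrC.
have f0 : f 0 = 0 by rewrite -[0](subrr 0) fB subrr.
have cK : closed_subspace [set x | f x = 0].
  apply: closed_subspace_intro => //; first exact: bounded_kernel_closed fk.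
  by move=> a x y /= fx fy; rewrite fL fx fy mulr0 addr0.
have [f00|] := pselect (forall x, f x = 0).
  by exists 0 => x; rewrite inner0r.
move=> /existsNP[x0 /eqP fx0]; have [c /= fc dK] := projection x0 cK.
set d := x0 - c in dK.
have fd : f d != 0 by rewrite /d fB fc subr0.
have dd0 : '[d, d] != 0.
  apply: contra_neq fd => /inner_eq0 ->; exact: f0.
exists (Num.conj (f d / '[d, d]) *: d) => x; rewrite innerZr conjCK.
have /dK : f (x - (f x / f d) *: d) = 0.
  by rewrite addrC -scaleNr fL; field.
rewrite innerBl innerZl => /eqP; rewrite subr_eq0 => /eqP ->.
by field; rewrite fd.
Qed.

End Hilbert.

(** * Adjoint pairs and contractions *)

Section Operators.
Variables (R : realType) (H : hilbertType R).
Implicit Types (x y z u v : H) (a : R[i]) (M L : set H) (T S X U V : H -> H).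

Local Notation "''[' x , y ]" := (@inner R H x y) : ring_scope.

Lemma inner_inj x y : (forall z, '[z, x] = '[z, y]) -> x = y.
Proof.
move=> xy; apply/eqP; rewrite -subr_eq0; apply/eqP/inner_eq0.
by rewrite innerBr xy subrr.
Qed.

(** Unlike [adjoint], this relation is symmetric and makes no choice; it also
    forces both maps to be linear, so that most of the development can work
    with plain functions. *)
Definition adjoint_pair T S := forall x y, '[T x, y] = '[x, S y].

Lemma adjoint_pair_sym T S : adjoint_pair T S -> adjoint_pair S T.
Proof. by move=> TS x y; rewrite inner_conj -TS -inner_conj. Qed.

Lemma adjoint_pair_adjoint T S : adjoint_pair T S -> adjoint T = S.
Proof.
move=> TS; apply/funext => y; apply: inner_inj => x; rewrite -TS /adjoint.
case: xgetP => [z _ /(_ x) //|/(_ (S y))] /=.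
by case=> x1; apply: TS.
Qed.

(** Riesz representation of the functionals x |-> '[T x, y]. *)
Lemma adjoint_pair_exists T : (forall a x y, T (a *: x + y) = a *: T x + T y) ->
  contractive T -> adjoint_pair T (adjoint T).
Proof.
move=> TL Tc.
suff [S TS] : exists S, adjoint_pair T S by rewrite (adjoint_pair_adjoint TS).
suff /choice[S SP] : forall y, exists z, forall x, '[T x, y] = '[x, z].
  by exists S => x y; apply: SP.
move=> y; apply: (@riesz _ _ (fun x => '[T x, y]) `|y|) => //.
  by move=> a x z; rewrite TL innerDl innerZl.
move=> x; rewrite mulrC (le_trans (cauchy_schwarz _ _))//.
by rewrite ler_wpM2r.
Qed.

Lemma unitary_adjoint_pair U : unitary U -> adjoint_pair U (adjoint U).
Proof.
move=> [Us Ui].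
suff [S TS] : exists S, adjoint_pair U S by rewrite (adjoint_pair_adjoint TS).
suff /choice[S SP] : forall y, exists z, U z = y.
  by exists S => x y; rewrite -{1}(SP y) Ui.
by move=> y; have : [set: H] y by []; rewrite -Us => -[z _ <-]; exists z.
Qed.

Lemma unitary_adjointK U : unitary U -> cancel U (adjoint U).
Proof.
move=> Uu x; apply: inner_inj => y.
by rewrite -(unitary_adjoint_pair Uu) Uu.2.
Qed.

Lemma unitaryK_adjoint U : unitary U -> cancel (adjoint U) U.
Proof.
move=> Uu y; have [Us Ui] := Uu.
have : [set: H] y by []; rewrite -Us => -[z _ <-].
by rewrite unitary_adjointK.
Qed.

Lemma unitary_adjoint U : unitary U -> unitary (adjoint U).
Proof.
move=> Uu; split=> [|x y _ _].
  by apply/seteqP; split=> // x _; exists (U x) => //; apply: unitary_adjointK.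
by rewrite -(unitary_adjoint_pair Uu) unitaryK_adjoint.
Qed.

Section Pair.
Variables (T S : H -> H) (TS : adjoint_pair T S).

Lemma pair_linear a x y : T (a *: x + y) = a *: T x + T y.
Proof.
have ST := adjoint_pair_sym TS.
by apply: inner_inj => z; rewrite -ST !innerDr !innerZr !ST.
Qed.

Lemma pair0 : T 0 = 0.
Proof. by apply: inner_inj => z; rewrite -(adjoint_pair_sym TS) !inner0r. Qed.

Lemma pair_iter m : adjoint_pair (iter m T) (iter m S).
Proof. by elim: m => // m IH x y; rewrite iterS TS IH -iterSr. Qed.

Lemma pair_defect m : adjoint_pair (defect S T m) (defect S T m).
Proof.
move=> x y; rewrite /defect innerBl innerBr.
by rewrite (adjoint_pair_sym (pair_iter m)) pair_iter.
Qed.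

Hypothesis Tc : contractive T.

Lemma pair_contractive : contractive S.
Proof.
move=> x; have [->|Sx0] := eqVneq (S x) 0; first by rewrite normr0.
have Sx : 0 < `|S x| by rewrite normr_gt0.
rewrite -(ler_pM2l Sx) -expr2 norm_inner -TS.
have rT : '[T (S x), x] \is Num.real.
  by rewrite TS ger0_real.
apply: le_trans (real_ler_norm rT) _; apply: le_trans (cauchy_schwarz _ _) _.
by rewrite ler_wpM2r.
Qed.

Lemma iter_contractive m : contractive (iter m T).
Proof. by elim: m => // m IH x; apply: le_trans (Tc _) (IH x). Qed.

(** Expanding the square gives |x - S T x|^2 = |S T x|^2 - |x|^2, which is at
    most 0 for contractions. *)
Lemma pair_norm_fixed x : `|T x| = `|x| -> S (T x) = x.
Proof.
move=> Tx; apply/eqP; rewrite eq_sym -subr_eq0; apply/eqP/inner_eq0.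
apply/le_anti; rewrite dnorm_ge0 andbT.
rewrite innerBl !innerBr -TS (adjoint_pair_sym TS) -(norm_inner (T x)) Tx.
rewrite -!norm_inner subrr sub0r opprB subr_le0.
by rewrite ler_pXn2r ?nnegrE // (le_trans (pair_contractive _)).
Qed.

Lemma pair_fixed_norm x : S (T x) = x -> `|T x| = `|x|.
Proof.
move=> STx; apply/eqP; rewrite -(@eqrXn2 _ 2%N) // !norm_inner.
by rewrite TS STx.
Qed.

End Pair.

Lemma defect_eq0 T S m x : adjoint_pair T S -> contractive T ->
  (defect S T m x = 0) <-> (`|iter m T x| = `|x|).
Proof.
move=> TS Tc; have TSm := pair_iter TS m; have Tcm := iter_contractive Tc m.
rewrite /defect; split.
  by move/eqP; rewrite subr_eq0 eq_sym => /eqP /(pair_fixed_norm TSm).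
by move=> /(pair_norm_fixed TSm Tcm) ->; rewrite subrr.
Qed.

End Operators.

(** * The unitary and completely non-unitary parts of one contraction *)

Section Wold.
Variables (R : realType) (H : hilbertType R).
Implicit Types (x y z u v : H) (a : R[i]) (M L : set H) (T S X U V : H -> H).

Local Notation "''[' x , y ]" := (@inner R H x y) : ring_scope.

(** For closed M this is the same as M reducing T, but it is easier to check
    on intersections. *)
Definition bistable T M :=
  forall x, M x -> M (T x) /\ M (adjoint T x).

Lemma bistable_iter T M m x : bistable T M -> M x ->
  M (iter m T x) /\ M (iter m (adjoint T) x).
Proof.
move=> TM Mx; split; elim: m => // m IH; rewrite iterS.
  by case: (TM _ IH).
by case: (TM _ IH).
Qed.

Lemma bistable_defect T M m x : closed_subspace M -> bistable T M -> M x ->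
  M (defect (adjoint T) T m x) /\ M (defect T (adjoint T) m x).
Proof.
move=> cM TM Mx; have [MT MS] := bistable_iter m TM Mx.
split; apply: (subspaceB cM Mx).
  by have [] := bistable_iter m TM MT.
by have [] := bistable_iter m TM MS.
Qed.

Lemma bistableI T M L : bistable T M -> bistable T L -> bistable T (M `&` L).
Proof. by move=> TM TL x [/TM[? ?] /TL[? ?]]. Qed.

Lemma bistable_orthocomp T M : adjoint_pair T (adjoint T) -> bistable T M ->
  bistable T (orthocomp M).
Proof.
move=> TS TM y My; split=> x Mx.
  by rewrite -(adjoint_pair_sym TS) My //; case: (TM _ Mx).
by rewrite -TS My //; case: (TM _ Mx).
Qed.

(** T^* preserves the orthogonal complement of whatever T preserves; apply
    this to the complement of M. *)
Lemma reduces_bistable T M : adjoint_pair T (adjoint T) ->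
  reduces T M -> bistable T M.
Proof.
move=> TS [cM _ TM TMo] x Mx; split; first by apply: TM; exists x.
rewrite -(orthocompK cM) => y My; rewrite -TS.
have [|_ TyM] := TMo (T y); first by exists y.
exact: ortho_sym TyM.
Qed.

Lemma bistable_reduces_in T M L : adjoint_pair T (adjoint T) ->
  bistable T M -> closed_subspace L -> L `<=` M -> bistable T L ->
  reduces_in M T L.
Proof.
move=> TS TM cL LM TL; split=> // _ [x + <-].
  by move=> Lx; case: (TL x Lx).
move=> [Mx Lx]; split; first by case: (TM x Mx).
by case: (bistable_orthocomp TS TL Lx).
Qed.

Lemma bistable_reduces T L : adjoint_pair T (adjoint T) ->
  closed_subspace L -> bistable T L -> reduces T L.
Proof. by move=> TS cL TL; apply: bistable_reduces_in. Qed.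

Lemma closed_span_subspace (A : set H) : closed_subspace (closed_span A).
Proof.
apply: closed_subspace_intro.
- move=> p clp M [cM AM]; apply: (subspace_closed cM) => B /clp[q [Aq Bq]].
  by exists q; split=> //; apply: Aq.
- by move=> M [cM AM]; apply: (subspace0 cM).
- by move=> a x y xA yA M cAM; apply: (subspaceZD cAM.1); [apply: xA|apply: yA].
Qed.

(** The space written [Hu T] in the introduction. *)
Definition unitary_space T := unitary_part T [set: H].

Section Contraction.
Variables (T : H -> H).
Local Notation S := (adjoint T).
Hypotheses (TS : adjoint_pair T S) (Tc : contractive T).
Local Notation Hu := (unitary_space T).

Let ST := adjoint_pair_sym TS.
Let Sc := pair_contractive TS Tc.

Lemma unitary_spaceP x : Hu x <->
  forall m, `|iter m T x| = `|x| /\ `|iter m S x| = `|x|.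
Proof.
split=> [xu m|xu m _].
  have [[_ Dx] [_ D'x]] := xu m I.
  by split; [apply/(defect_eq0 _ _ TS Tc)|apply/(defect_eq0 _ _ ST Sc)].
have [Tx Sx] := xu m.
split; split=> //=; first exact/(defect_eq0 _ _ TS Tc).
exact/(defect_eq0 _ _ ST Sc).
Qed.

Lemma unitary_space_defect m x : Hu x ->
  defect S T m x = 0 /\ defect T S m x = 0.
Proof. by move=> /(_ m I)[[_ ?] [_ ?]]. Qed.

Lemma unitary_spaceK x : Hu x -> S (T x) = x /\ T (S x) = x.
Proof.
move=> /(unitary_space_defect 1)[/eqP + /eqP]; rewrite !subr_eq0 /=.
by move=> /eqP e1 /eqP e2; split; apply/esym.
Qed.

(** On [Hu T] the operators T and T^* are inverse to each other, so applying
    one of them only shifts the exponents in [unitary_spaceP]. *)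
Lemma unitary_space_bistable : bistable T Hu.
Proof.
move=> x xu; have [STx TSx] := unitary_spaceK xu.
have /unitary_spaceP xu' := xu.
have Tx : `|T x| = `|x| := (xu' 1%N).1; have Sx : `|S x| = `|x| := (xu' 1%N).2.
split; apply/unitary_spaceP => m.
  rewrite Tx -iterSr (xu' _).1; split=> //.
  by case: m => // m; rewrite iterSr STx (xu' _).2.
rewrite Sx -iterSr (xu' _).2; split=> //.
by case: m => // m; rewrite iterSr TSx (xu' _).1.
Qed.

(** The defect operators are self-adjoint, so their common kernel is the
    orthogonal complement of their ranges. *)
Lemma unitary_space_subspace : closed_subspace Hu.
Proof.
pose D : set H :=
  [set z | exists m y, z = defect S T m y \/ z = defect T S m y].
rewrite (_ : Hu = orthocomp D); first exact: orthocomp_closed_subspace.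
apply/seteqP; split=> x xu.
  move=> _ [m [y []]] ->; have [Dx D'x] := unitary_space_defect m xu.
    by rewrite (pair_defect TS) Dx inner0r.
  by rewrite (pair_defect ST) D'x inner0r.
move=> m _; split; split=> //=; apply: inner_inj => y; rewrite inner0r.
  by rewrite -(pair_defect TS) xu //; exists m, y; left.
by rewrite -(pair_defect ST) xu //; exists m, y; right.
Qed.

Lemma unitary_partE M : unitary_part T M = M `&` Hu.
Proof.
apply/seteqP; split=> x.
  move=> xu; split; first by case: (xu 0%N I) => -[].
  by move=> m _; case: (xu m I) => -[_ ?] [_ ?].
by move=> [Mx xu] m _; case: (xu m I) => -[_ ?] [_ ?].
Qed.

Lemma cnu_part_sub M : closed_subspace M -> bistable T M ->
  cnu_part T M `<=` M `&` orthocomp Hu.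
Proof.
move=> cM TM x; apply; split.
  exact: closed_subspaceI cM (orthocomp_closed_subspace _).
move=> z [m _ [[y My <-]|[y My <-]]];
  have [MD MD'] := bistable_defect m cM TM My; split=> // w wu;
  have [Dw D'w] := unitary_space_defect m wu.
  by rewrite -(pair_defect TS) Dw inner0l.
by rewrite -(pair_defect ST) D'w inner0l.
Qed.

(** The defect operators preserve M and are self-adjoint, so a vector of M
    orthogonal to their ranges on M is in their kernels. *)
Lemma cnu_part_split M x : closed_subspace M -> bistable T M -> M x ->
  exists2 c, cnu_part T M c & (M `&` Hu) (x - c).
Proof.
move=> cM TM Mx.
have cC : closed_subspace (cnu_part T M) by apply: closed_span_subspace.
have [c Cc xc] := projection x cC.
have [Mc cu] := cnu_part_sub cM TM Cc.
exists c => //; have Mxc := subspaceB cM Mx Mc; split=> // m _.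
have spanD m' y : M y ->
    cnu_part T M (defect S T m' y) /\ cnu_part T M (defect T S m' y).
  by move=> My; split=> C [_ CA]; apply: CA; exists m' => //;
    [left|right]; exists y.
have [MD MD'] := bistable_defect m cM TM Mxc.
split; split=> //=; apply: inner_eq0.
  by rewrite (pair_defect TS) (ortho_sym (spanD m _ MD).1 xc).
by rewrite (pair_defect ST) (ortho_sym (spanD m _ MD').2 xc).
Qed.

Lemma cnu_partE M : closed_subspace M -> bistable T M ->
  cnu_part T M = M `&` orthocomp Hu.
Proof.
move=> cM TM; apply/seteqP; split; first exact: cnu_part_sub.
move=> x [Mx xu]; have [c Cc [Mxc xcu]] := cnu_part_split cM TM Mx.
suff /eqP : x - c = 0 by rewrite subr_eq0 => /eqP ->.
have [_ cu] := cnu_part_sub cM TM Cc.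
by apply: inner_eq0; apply: (subspaceB (orthocomp_closed_subspace Hu) xu cu).
Qed.

(** A surjective isometry of M has T^* as its inverse on M, so the powers of
    T and of T^* are isometric on M. *)
Lemma unitary_on_sub M : unitary_on M T -> M 0 -> M `<=` Hu.
Proof.
move=> [MT Ti] M0.
have Tn x : M x -> `|T x| = `|x|.
  by move=> Mx; apply/eqP; rewrite -(@eqrXn2 _ 2%N) // !norm_inner Ti.
have TM x : M x -> M (T x) by move=> Mx; rewrite -MT; exists x.
have SM x : M x -> M (S x) /\ `|S x| = `|x|.
  rewrite -{1}MT => -[z Mz <-].
  by rewrite (pair_norm_fixed TS Tc (Tn z Mz)) Tn.
move=> x Mx; apply/unitary_spaceP => m; split.
  suff [] : M (iter m T x) /\ `|iter m T x| = `|x| by [].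
  by elim: m => // m [IH1 IH2]; rewrite iterS Tn //; split=> //; apply: TM.
suff [] : M (iter m S x) /\ `|iter m S x| = `|x| by [].
by elim: m => // m [/SM[? IH1] IH2]; rewrite iterS IH1.
Qed.

Lemma unitary_on_sub_unitary_space M : bistable T M -> M `<=` Hu ->
  unitary_on M T.
Proof.
move=> TM Mu; split; last first.
  by move=> x y Mx My; rewrite TS (unitary_spaceK (Mu _ My)).1.
apply/seteqP; split=> [_ [x Mx <-]|x Mx]; first by case: (TM _ Mx).
by exists (S x); [case: (TM _ Mx)|rewrite (unitary_spaceK (Mu _ Mx)).2].
Qed.

Lemma cnu_on_sub_orthocomp M : M `<=` orthocomp Hu -> cnu_on M T.
Proof.
move=> Mo L [cL LM _ _] uL; have L0 := subspace0 cL.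
have Lu := unitary_on_sub uL L0.
apply/seteqP; split=> x; last by move=> ->.
by move=> Lx; apply: inner_eq0; apply: Mo (LM _ Lx) _ (Lu _ Lx).
Qed.

Lemma cnu_on_unitary_space M x : closed_subspace M -> bistable T M ->
  cnu_on M T -> M x -> Hu x -> x = 0.
Proof.
move=> cM TM Mc Mx xu.
have TL := bistableI TM unitary_space_bistable.
have cL := closed_subspaceI cM unitary_space_subspace.
suff L0 : M `&` Hu = [set 0] by have : (M `&` Hu) x by []; rewrite L0.
apply: Mc; first by apply: bistable_reduces_in => // y [].
by apply: unitary_on_sub_unitary_space => // y [].
Qed.

Lemma bistable_split M x : closed_subspace M -> bistable T M -> M x ->
  exists2 u, (M `&` Hu) u & (M `&` orthocomp Hu) (x - u).
Proof.
move=> cM TM Mx; have [c Cc xc] := cnu_part_split cM TM Mx.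
by exists (x - c) => //; rewrite opprB subrKC -cnu_partE.
Qed.

End Contraction.
End Wold.

(** * Families whose unitary spaces reduce each other *)

Section Families.
Variables (R : realType) (H : hilbertType R).
Implicit Types (x y z u v : H).

Local Notation "''[' x , y ]" := (@inner R H x y) : ring_scope.

Definition unitary_or_cnu_space (T : H -> H) (b : bool) : set H :=
  if b then orthocomp (unitary_space T) else unitary_space T.

Definition joint_type_space n (T : 'I_n -> H -> H) (A : {set 'I_n}) : set H :=
  [set x | forall i, unitary_or_cnu_space (T i) (i \in A) x].

(** What remains of the twisted relations once the twist is eliminated. *)
Record compatible n (T : 'I_n -> H -> H) := Compatible {
  compatible_adj : forall i, adjoint_pair (T i) (adjoint (T i));
  compatible_contr : forall i, contractive (T i);
  compatible_stable : forall i j, bistable (T j) (unitary_space (T i)) }.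

Lemma unitary_or_cnu_space_bistable (T X : H -> H) b :
  adjoint_pair X (adjoint X) ->
  bistable X (unitary_space T) -> bistable X (unitary_or_cnu_space T b).
Proof. by case: b => //=; apply: bistable_orthocomp. Qed.

Lemma joint_type_space_bistable n (T : 'I_n -> H -> H) (X : H -> H) A :
  adjoint_pair X (adjoint X) -> (forall i, bistable X (unitary_space (T i))) ->
  bistable X (joint_type_space T A).
Proof.
move=> adjX stX x Ax; split=> i;
  by have [] := unitary_or_cnu_space_bistable adjX (stX i) (Ax i).
Qed.

Lemma compatible_init n (T : 'I_n.+1 -> H -> H) :
  compatible T -> compatible (init_ops T).
Proof. by case=> adj con st; split=> *; [apply: adj|apply: con|apply: st]. Qed.

Section Compatible.
Variables (n : nat) (T : 'I_n -> H -> H) (cT : compatible T).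
Let adj := compatible_adj cT.
Let con := compatible_contr cT.
Let stab := compatible_stable cT.
Local Notation V i b := (unitary_or_cnu_space (T i) b).

Lemma unitary_or_cnu_space_subspace i b : closed_subspace (V i b).
Proof.
case: b; first exact: orthocomp_closed_subspace.
exact: unitary_space_subspace.
Qed.

Lemma joint_type_space_subspace A : closed_subspace (joint_type_space T A).
Proof.
by apply: closed_subspace_forall => i; apply: unitary_or_cnu_space_subspace.
Qed.

Lemma unitary_or_cnu_space_orthogonal i b c x y :
  b != c -> V i b x -> V i c y -> '[x, y] = 0.
Proof.
case: b c => -[] // _ /= Vx Vy; last exact: Vy.
exact: ortho_sym Vy Vx.
Qed.

Lemma joint_type_space_orthogonal A B x y :
  A != B -> joint_type_space T A x -> joint_type_space T B y -> '[x, y] = 0.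
Proof.
move=> AB Ax By; have [i iAB] : exists i, (i \in A) != (i \in B).
  apply/existsP; rewrite -negb_forall; apply: contra AB => /forallP AB.
  by apply/eqP/setP => i; apply/eqP.
exact: unitary_or_cnu_space_orthogonal iAB (Ax i) (By i).
Qed.

(** Induction on the indices i for which it is not yet known that x lies in
    [Hu T_i] or in its complement: x is the sum of its projections for the
    first such i, and these keep the types already known. *)
Lemma joint_type_space_sum h : exists2 f : {set 'I_n} -> H,
  forall A, joint_type_space T A (f A) & h = \sum_A f A.
Proof.
suff step (s : seq 'I_n) : forall x,
    (forall i, i \notin s -> exists b, V i b x) ->
    exists2 f : {set 'I_n} -> H,
      forall A, joint_type_space T A (f A) & x = \sum_A f A.
  by apply: (step (enum 'I_n)) => i; rewrite mem_enum.
elim: s => [|i s IH] x xP.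
  have [b bP] := choice (fun i => xP i isT).
  pose A := [set i | b i]%SET.
  exists (fun B => if B == A then x else 0) => [B|].
    case: eqVneq => [->|_]; last exact: subspace0 (joint_type_space_subspace _).
    by move=> i; rewrite inE; apply: bP.
  by rewrite -big_mkcond big_pred1_eq.
suff [u uP xuP] : exists2 u,
    (forall j, j \notin s -> exists b, V j b u) &
    (forall j, j \notin s -> exists b, V j b (x - u)).
  have [f fP uf] := IH _ uP; have [g gP xug] := IH _ xuP.
  exists (fun A => f A + g A) => [A|].
    exact: (subspaceD (joint_type_space_subspace A)).
  by rewrite big_split /= -uf -xug subrKC.
(* M is the set of all y that have every known type of x; projecting inside M
   keeps those types. *)
pose M := [set y | forall p : {p : 'I_n * bool | V p.1 p.2 x},
  V (sval p).1 (sval p).2 y].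
have cM : closed_subspace M.
  by apply: closed_subspace_forall => p; apply: unitary_or_cnu_space_subspace.
have TM : bistable (T i) M.
  move=> y My; split=> p;
    by have [] := unitary_or_cnu_space_bistable (adj i) (@stab _ i) (My p).
have Mx : M x by case.
have [u [Mu uu] [Mxu xuu]] := bistable_split (adj i) cM TM Mx.
exists u => j js.
  have [->|ji] := eqVneq j i; first by exists false.
  have [|b Vx] := xP j; first by rewrite inE negb_or ji.
  by exists b; apply: (Mu (exist _ (j, b) Vx)).
have [->|ji] := eqVneq j i; first by exists true.
have [|b Vx] := xP j; first by rewrite inE negb_or ji.
by exists b; apply: (Mxu (exist _ (j, b) Vx)).
Qed.

Lemma joint_type_space_decomposition :
  unitary_cnu_decomposition T (joint_type_space T).
Proof.
split.
- exact: joint_type_space_subspace.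
- move=> A i; apply: bistable_reduces (joint_type_space_subspace _) _ => //.
  exact: joint_type_space_bistable.
- split; last exact: joint_type_space_sum.
  by move=> A B AB x y; apply: joint_type_space_orthogonal.
- move=> A _ i; split=> iA.
    apply: unitary_on_sub_unitary_space => //.
      exact: joint_type_space_bistable.
    by move=> x /(_ i); rewrite (negbTE iA).
  by apply: cnu_on_sub_orthocomp => // x /(_ i); rewrite iA.
Qed.

Section Uniqueness.
Variables (K : {set 'I_n} -> set H) (hK : unitary_cnu_decomposition T K).

Let cK A : closed_subspace (K A). Proof. by case: hK. Qed.
Let bK A i : bistable (T i) (K A).
Proof. by apply: reduces_bistable; [apply: adj|case: hK]. Qed.

Lemma decomposition_component (f : {set 'I_n} -> H) A x :
  (forall B, K B (f B)) -> K A x -> '[x, \sum_B f B] = '[x, f A].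
Proof.
case: hK => _ _ [oK _] _ Kf Kx; rewrite inner_sumr (bigD1 A) //= big1 ?addr0 //.
by move=> B BA; apply: oK Kx (Kf B); rewrite eq_sym.
Qed.

(** Defect operators preserve every K A, so a defect of the sum vanishes only
    if the defects of all the components do. *)
Lemma decomposition_unitary_component i (f : {set 'I_n} -> H) :
  (forall B, K B (f B)) -> unitary_space (T i) (\sum_B f B) ->
  forall A, unitary_space (T i) (f A).
Proof.
move=> Kf fu A m _; have TS := adj i; have ST := adjoint_pair_sym TS.
have [D0 D'0] := unitary_space_defect m fu.
have [KD KD'] := bistable_defect m (cK A) (@bK A i) (Kf A).
have [KDD _] := bistable_defect m (cK A) (@bK A i) KD.
have [_ KDD'] := bistable_defect m (cK A) (@bK A i) KD'.
split; split=> //=; apply: inner_eq0.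
  rewrite (pair_defect TS) inner_conj -(decomposition_component Kf KDD).
  by rewrite (pair_defect TS) D0 inner0r conjC0.
rewrite (pair_defect ST) inner_conj -(decomposition_component Kf KDD').
by rewrite (pair_defect ST) D'0 inner0r conjC0.
Qed.

Lemma decomposition_sub A : K A `<=` joint_type_space T A.
Proof.
move=> x Kx i.
have [K0|K0] := pselect (K A = [set 0]).
  move: Kx; rewrite K0 => ->.
  exact: subspace0 (unitary_or_cnu_space_subspace _ _).
case: hK => _ _ [_ sumK] /(_ A K0 i) [uK nK].
case: (boolP (i \in A)) => iA /=; last first.
  have := unitary_on_sub (adj i) (@con i) (uK iA) (subspace0 (cK A)).
  exact.
move=> y yu; have [f Kf yE] := sumK y.
rewrite inner_conj yE (decomposition_component Kf Kx).
rewrite (_ : f A = 0) ?inner0r ?conjC0 //.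
apply: (cnu_on_unitary_space (adj i) (@con i) (cK A) (@bK A i) (nK iA)) => //.
by apply: decomposition_unitary_component Kf _ _; rewrite -yE.
Qed.

(** A vector x of [joint_type_space T A] is orthogonal to all K B with B
    different from A, as these lie in other joint type spaces; so its only
    nonzero component is in K A. *)
Lemma decomposition_unique A : K A = joint_type_space T A.
Proof.
apply/seteqP; split; first exact: decomposition_sub.
move=> x Ax; case: hK => _ _ [_ /(_ x)[f Kf xE]] _.
suff fB B : B != A -> f B = 0.
  by rewrite xE (bigD1 A) //= big1 ?addr0.
move=> BA; apply: inner_eq0; rewrite -(decomposition_component Kf (Kf B)) -xE.
by apply: joint_type_space_orthogonal BA _ Ax; apply: decomposition_sub.
Qed.

End Uniqueness.
End Compatible.

Lemma wold_spaceE n (T : 'I_n -> H -> H) : compatible T ->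
  wold_space T = joint_type_space T.
Proof.
elim: n T => [|n IH] T cT; apply/funext => A.
  by apply/seteqP; split=> // x _ [].
have ci := compatible_init cT.
have adj := compatible_adj cT ord_max; have con := compatible_contr cT ord_max.
have -> : wold_space T A = joint_type_space (init_ops T) (init_set A) `&`
    unitary_or_cnu_space (T ord_max) (ord_max \in A).
  rewrite /= (IH _ ci).
  case: (ord_max \in A); last exact: unitary_partE.
  apply: cnu_partE => //; first exact: joint_type_space_subspace.
  by apply: joint_type_space_bistable => // i; apply: compatible_stable cT _ _.
apply/seteqP; split=> x.
  move=> [xi xm] i; case: (unliftP ord_max i) => [j ->|->] //.
  have := xi j; rewrite /init_ops inE.
  rewrite (_ : lift ord_max j = widen_ord (leqnSn n) j) //.
  by apply: val_inj; rewrite /= /bump leqNgt ltn_ord.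
move=> Ax; split; last exact: Ax.
by move=> j; rewrite inE; apply: Ax.
Qed.
End Families.

(** * Twisted families *)

Section Twisted.
Variables (R : realType) (H : hilbertType R).
Implicit Types (x y z u v : H) (S X U T : H -> H).

(** S^m X = U^m X S^m and S'^m U^m X = X S'^m: the power of U produced by S is
    absorbed by S'. *)
Lemma iter_twist S (S' : H -> H) X U (U' : H -> H) m x :
  cancel U' U ->
  (forall x, S (U x) = U (S x)) -> (forall x, S' (U x) = U (S' x)) ->
  (forall x, S (X x) = U (X (S x))) -> (forall x, S' (X x) = U' (X (S' x))) ->
  iter m S' (iter m S (X x)) = X (iter m S' (iter m S x)).
Proof.
move=> U'K SU S'U SX S'X.
have iterSX k y : iter k S (X y) = iter k U (X (iter k S y)).
  elim: k => // k IH; rewrite iterS IH.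
  have -> z : S (iter k U z) = iter k U (S z).
    by elim: k {IH} => //= k IH; rewrite SU IH.
  by rewrite SX -iterSr.
rewrite iterSX; move: (iter m S x) => {}x.
have S'UX y : S' (U (X y)) = X (S' y) by rewrite S'U S'X U'K.
elim: m x => // m IH x.
rewrite [iter m.+1 S' _]iterSr.
have -> : S' (iter m.+1 U (X x)) = iter m U (X (S' x)).
  rewrite iterSr; have -> z : S' (iter m U z) = iter m U (S' z).
    by elim: m {IH} => //= k IH; rewrite S'U IH.
  by rewrite S'UX.
by rewrite IH -iterSr.
Qed.

Lemma commute_adjoint (D X : H -> H) :
  adjoint_pair D D -> adjoint_pair X (adjoint X) ->
  (forall x, D (X x) = X (D x)) ->
  forall x, D (adjoint X x) = adjoint X (D x).
Proof.
move=> DD XX DX x; apply: inner_inj => z.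
by rewrite -DD -XX -DX DD XX.
Qed.

(** The defects are self-adjoint, hence commute with the adjoint of X too. *)
Lemma unitary_space_commute T X :
  adjoint_pair T (adjoint T) -> adjoint_pair X (adjoint X) ->
  (forall m x, defect (adjoint T) T m (X x) = X (defect (adjoint T) T m x)) ->
  (forall m x, defect T (adjoint T) m (X x) = X (defect T (adjoint T) m x)) ->
  bistable X (unitary_space T).
Proof.
move=> TS XX D1 D2 x xu; have ST := adjoint_pair_sym TS.
have X0 := pair0 XX; have S0 := pair0 (adjoint_pair_sym XX).
split=> m _; have [Dx D'x] := unitary_space_defect m xu.
  by split; split=> //=; rewrite ?D1 ?D2 ?Dx ?D'x.
split; split=> //=.
  by rewrite (commute_adjoint (pair_defect TS m) XX (D1 m)) Dx.
by rewrite (commute_adjoint (pair_defect ST m) XX (D2 m)) D'x.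
Qed.

Lemma twist_bistable T X U :
  unitary U -> adjoint_pair T (adjoint T) -> adjoint_pair X (adjoint X) ->
  (forall x, T (X x) = U (X (T x))) ->
  (forall x, adjoint T (X x) = adjoint U (X (adjoint T x))) ->
  (forall x, T (U x) = U (T x)) ->
  bistable X (unitary_space T).
Proof.
move=> Uu TS XX TX SX TU; set S := adjoint T in TS SX *.
set U' := adjoint U in SX.
have UK : cancel U U' by apply: unitary_adjointK.
have U'K : cancel U' U by apply: unitaryK_adjoint.
have TU' x : T (U' x) = U' (T x) by rewrite -{2}(U'K x) TU UK.
have SU x : S (U x) = U (S x).
  have U'U : adjoint_pair U' U := adjoint_pair_sym (unitary_adjoint_pair Uu).
  apply: inner_inj => z.
  by rewrite -TS -U'U -TU' TS U'U.
have SU' x : S (U' x) = U' (S x) by rewrite -{2}(U'K x) SU UK.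
have XB := pair_linear XX.
have XBB x y : X (x - y) = X x - X y.
  by rewrite addrC -scaleN1r XB scaleN1r addrC.
by apply: unitary_space_commute => // m x; rewrite /defect XBB; congr (_ - _);
  [exact: (@iter_twist T S X U U')|exact: (@iter_twist S T X U' U)].
Qed.

Lemma twisted_compatible n (T : 'I_n -> {linear H -> H}) :
  twisted_contraction T -> compatible T.
Proof.
move=> [U [[Uu _] Tc tw]].
have adj i : adjoint_pair (T i) (adjoint (T i)).
  by apply: adjoint_pair_exists => // a x y; apply: linearP.
split=> // i j; have [<-|ij] := eqVneq i j.
  exact: unitary_space_bistable.
have twu : unitary (twist U i j).
  rewrite /twist; case: ltnP => [/Uu //|ji].
  by apply/unitary_adjoint/Uu; rewrite ltn_neqAle eq_sym ij.
have [TT ST TU] := tw i j i ij.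
exact: (twist_bistable twu).
Qed.
End Twisted.

(* The n >= 2 operators are T_1, ..., T_n with n := m.+2; T_n is T ord_max. *)
Theorem theorem4p2 (R : realType) (H : hilbertType R) (m : nat)
    (T : 'I_m.+2 -> {linear H -> H}) (hT : twisted_contraction T) :
  exists K : {set 'I_m.+2} -> set H,
    [/\ unitary_cnu_decomposition T K,
        forall A : {set 'I_m.+2}, ord_max \notin A ->
          K A = unitary_part (T ord_max)
                  (wold_space (init_ops T) (init_set A)),
        forall A : {set 'I_m.+2}, ord_max \in A ->
          K A = cnu_part (T ord_max)
                  (wold_space (init_ops T) (init_set A)) &
        forall K' : {set 'I_m.+2} -> set H,
          unitary_cnu_decomposition T K' -> forall A, K' A = K A].
Proof.
have cT := twisted_compatible hT.
exists (wold_space T); split.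
- by rewrite wold_spaceE //; apply: joint_type_space_decomposition.
- by move=> A nA; rewrite /= (negbTE nA).
- by move=> A nA; rewrite /= nA.
- by move=> K' hK A; rewrite wold_spaceE //; apply: decomposition_unique.
Qed.
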